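(* Let $\ell_1,\ell_2\in\mathbb{N}\setminus\{1\}$ satisfy $\gcd(\ell_1,\ell_2)=1$, and let $$p(x,y):=q(x,y)\bigl(x^{\ell_1}y^{\ell_2}-1\bigr),\qquad q(x,y)\in\{x,y,xy\}.$$ Suppose that $n\ge\deg p$. Then every $f\in\mathcal{P}_{2n}$ that is strictly positive on $\mathcal{Z}_p$ admits a representation $$f=\sum_{j=1}^r g_j^2+ph,$$ where $g_1,\ldots,g_r,h\in\mathbb{R}[x,y]$ and $g_j^2,\ ph\in\mathcal{P}_{2\left(n+2(\ell_1+\ell_2)\right)}$ for $j=1,\ldots,r$.
   Context: Here $\mathbb{N}=\{1,2,\ldots\}$, $\mathcal{P}_m=\{f\in\mathbb{R}[x,y]:\deg f\le m\}$, and $\mathcal{Z}_p=\{(x,y)\in\mathbb{R}^2:p(x,y)=0\}$. *)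

(* Defs.v *)
From mathcomp Require Import all_boot all_order all_algebra.
From mathcomp Require Import reals.
From mathcomp Require Import mpoly.
Set Implicit Arguments.
Unset Strict Implicit.
Unset Printing Implicit Defensive.

Import GRing.Theory Num.Theory.
Local Open Scope ring_scope.

(* R[x,y] is {mpoly R[2]}: x and y are the variables of index 0 and 1, and a
   point of the plane is a map v : 'I_2 -> R with coordinates v 0 and v 1. *)
Definition xvar (R : realType) : {mpoly R[2]} := 'X_0.
Definition yvar (R : realType) : {mpoly R[2]} := 'X_1.
Arguments xvar {R}.
Arguments yvar {R}.

(* msize f is 1 + deg f for f != 0, and msize 0 = 0, so 0 has degree <= m for
   every m. *)
Definition deg_le (R : realType) (m : nat) (f : {mpoly R[2]}) : Prop :=
  (msize f <= m.+1)%N.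

Definition zero_set (R : realType) (p : {mpoly R[2]}) (v : 'I_2 -> R) : Prop :=
  p.@[v] = 0.

Definition positive_on (R : realType) (Z : ('I_2 -> R) -> Prop)
    (f : {mpoly R[2]}) : Prop :=
  forall v, Z v -> 0 < f.@[v].

(* Main.v *)
Require Import Defs.
From mathcomp Require Import all_boot all_order all_algebra.
From mathcomp Require Import reals complex polyrcf ring lra zify.
From mathcomp Require Import mpoly.
Set Implicit Arguments.
Unset Strict Implicit.
Unset Printing Implicit Defensive.

Import Order.TTheory GRing.Theory Num.Theory.
Local Open Scope ring_scope.

(** Write a = l1, b = l2 and M = x^a y^b.  Since q divides M, the polynomials q
    and M - 1 are comaximal: the zero set of p = q (M - 1) is the disjoint union
    of the curve M = 1 and of one or both coordinate axes, and sums of squares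
    found separately on the two pieces can be glued.  If f is congruent to
    L1^2 + L2^2 modulo q and to K1^2 + K2^2 modulo M - 1, then
    g_i = M K_i + (1 - M) L_i is congruent to L_i modulo q and to K_i modulo
    M - 1, so p divides f - g1^2 - g2^2 ([eqmod_crt]).  With deg L_i <= n and
    deg K_i <= n + a + b this gives deg g_i <= n + 2(a + b), and the bound on
    p h = f - g1^2 - g2^2 follows.

    On the axes ([axes_sum2sqr]) the restrictions of f are univariate
    polynomials of degree at most 2n that are positive on R, hence sums of two
    squares of polynomials of degree at most n ([nonneg_poly_sum2sqr]).  When
    q = xy, the two representations must in addition agree at the origin; a
    rotation of each pair (A, B) gives both the value (sqrt(f(0,0)), 0) there.

    The curve ([curve_sum2sqr]) is parametrized by t |-> (t^b, t^-a), t <> 0,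
    because a and b are coprime; its coordinate ring is the ring of Laurent
    polynomials in t, a monomial x^i y^j being t^(bi - aj).  Thus
    t^(2na) f(t^b, t^-a) is a univariate polynomial of degree at most
    2n(a + b), nonnegative on R, and so a sum of two squares A^2 + B^2 with
    A and B of degree at most n(a + b).  Each t^(k - na) with k <= n(a + b) is
    the restriction of a monomial of degree at most n + a + b
    ([low_degree_exponents]), which lifts t^(-na) A and t^(-na) B to K1 and K2. *)

(** * Nonnegative univariate polynomials are sums of two squares *)

(** Continuity at r, used along a half-line of direction s: at a real root the
    cofactor of a nonnegative polynomial has known signs on the two sides only. *)
Lemma horner_ge0_limit (R : rcfType) (P : {poly R}) (r s : R) :
  s != 0 -> (forall e, 0 < e -> 0 <= P.[r + s * e]) -> 0 <= P.[r].
Proof.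
move=> s0 Ppos; rewrite leNgt; apply/negP => Pr0.
have [d d0 Hd] := @poly_cont R r P (- P.[r]) ltac:(by rewrite oppr_gt0).
have ns0 : 0 < `|s| by rewrite normr_gt0.
have e0 : 0 < d / (2 * `|s|) by rewrite divr_gt0 // mulr_gt0.
have := Hd (r + s * (d / (2 * `|s|))).
have -> : `|r + s * (d / (2 * `|s|)) - r| = d / 2.
  rewrite [r + _]addrC addrK normrM (gtr0_norm e0).
  by field; rewrite lt0r_neq0.
move=> /(_ ltac:(lra)); have := Ppos _ e0.
by rewrite ltr_norml => ? /andP[? ?]; lra.
Qed.

(** A complex root al + i be either is real or has a monic real quadratic minimal
    polynomial, positive on the line. *)
Lemma real_root_or_quadratic_factor (R : rcfType) (P : {poly R}) :
  (1 < size P)%N ->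
  (exists r, root P r) \/
  exists al be, be != 0 /\ ('X - al%:P) ^+ 2 + (be ^+ 2)%:P %| P.
Proof.
move=> sP; set toC := real_complex R.
have /closed_rootP[[al be] rz] : size (map_poly toC P) != 1%N.
  by rewrite size_map_poly neq_ltn sP orbT.
have [be0|be0] := eqVneq be 0.
  left; exists al; move: rz; rewrite be0.
  by rewrite -[(al +i* 0)%C]/(toC al) rootE horner_map fmorph_eq0.
right; exists al, be; split => //.
set Q := _ + _ : {poly R}.
have sQ : size Q = 3%N.
  rewrite /Q size_polyDl size_exp_XsubC //.
  by rewrite (leq_ltn_trans (size_polyC_leq1 _)).
have sr : (size (P %% Q)%R <= 2)%N by rewrite -ltnS -sQ ltn_modp -size_poly_gt0 sQ.
have Qz : (map_poly toC Q).[(al +i* be)%C] = 0.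
  rewrite rmorphD rmorphXn /= rmorphB /= map_polyX !map_polyC /= !hornerE.
  by apply/eqP; rewrite eq_complex /= ; apply/andP; split; apply/eqP; ring.
have : (map_poly toC (P %% Q)).[(al +i* be)%C] = 0.
  move: rz; rewrite {1}(divp_eq P Q) rmorphD rmorphM /= rootE hornerD hornerM.
  by rewrite Qz mulr0 add0r => /eqP.
rewrite (horner_coef_wide _ (n := 2)) ?size_map_poly //.
rewrite !big_ord_recl big_ord0 /= !coef_map /= => /eqP.
rewrite eq_complex /= => /andP[/eqP h1 /eqP h2].
(* The remainder c0 + c1 X vanishes at al + i be: its imaginary part gives
   c1 be = 0, and then its real part gives c0 = 0. *)
have c1 : (P %% Q)`_1 = 0.
  apply: (mulIf be0); rewrite mul0r; apply: etrans h2.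
  by rewrite /bump /=; ring.
have c0 : (P %% Q)`_0 = 0.
  by apply: etrans h1; rewrite /bump /= c1; ring.
rewrite /dvdp; apply/eqP/polyP => [[|[|i]]]; rewrite coef0 //.
by apply: nth_default; apply: leq_trans sr _.
Qed.

(** Induction on the degree.  A real root has even multiplicity, so that a square
    (X - r)^2 splits off; otherwise a factor (X - al)^2 + be^2 splits off and
    the identity (C^2 + D^2)(A^2 + B^2) = (CA - DB)^2 + (CB + DA)^2 applies. *)
Lemma nonneg_poly_sum2sqr (R : rcfType) (k : nat) (P : {poly R}) :
  (size P <= (2 * k).+1)%N -> (forall x, 0 <= P.[x]) ->
  exists A B : {poly R},
    [/\ P = A ^+ 2 + B ^+ 2, (size A <= k.+1)%N & (size B <= k.+1)%N].
Proof.
elim: k P => [|k IH] P sP Ppos.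
  have Pc := size1_polyC sP.
  exists (Num.sqrt P`_0)%:P, 0; split.
  - rewrite -rmorphXn /= sqr_sqrtr ?[RHS]addr0 ?expr0n ?addr0 //.
    by have := Ppos 0; rewrite horner_coef0.
  - exact: size_polyC_leq1.
  - by rewrite size_poly0.
have [sP1|sP1] := leqP (size P) 1.
  have [|A [B [-> sA sB]]] := IH P _ Ppos; first exact: leq_trans sP1 _.
  by exists A, B; split => //; apply: leqW.
have P0 : P != 0 by rewrite -size_poly_gt0 ltnW.
have [[r]|] := real_root_or_quadratic_factor sP1.
  case/factor_theorem => Q PQ.
  (* Q is nonnegative to the right of r and nonpositive to its left. *)
  have Qr : root Q r.
    rewrite rootE eq_le -oppr_ge0 -hornerN; apply/andP; split.
      apply: (@horner_ge0_limit _ _ _ (-1)); first by rewrite oppr_eq0 oner_eq0.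
      move=> e e0; have := Ppos (r + -1 * e).
      have -> : P.[r + -1 * e] = e * (- Q).[r + -1 * e].
        by rewrite PQ hornerN hornerM hornerXsubC; ring.
      by rewrite pmulr_rge0.
    apply: (@horner_ge0_limit _ _ _ 1); first by rewrite oner_eq0.
    move=> e e0; have := Ppos (r + 1 * e).
    have -> : P.[r + 1 * e] = e * Q.[r + 1 * e].
      by rewrite PQ hornerM hornerXsubC; ring.
    by rewrite pmulr_rge0.
  case/factor_theorem: Qr => S QS.
  have PS : P = S * ('X - r%:P) ^+ 2 by rewrite PQ QS -mulrA.
  have S0 : S != 0 by apply: contraNneq P0 => S0; rewrite PS S0 mul0r.
  have sS : (size S <= (2 * k).+1)%N.
    move: sP; rewrite PS size_Mmonic ?monic_exp ?monicXsubC //.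
    by rewrite size_exp_XsubC addn3 mulnS.
  have Spos x : x != r -> 0 <= S.[x].
    move=> xr; have := Ppos x.
    rewrite PS hornerM horner_exp hornerXsubC pmulr_lge0 //.
    by rewrite exprn_even_gt0 //= subr_eq0.
  have [|A [B [SAB sA sB]]] := IH S sS.
    move=> x; have [->|] := eqVneq x r; last exact: Spos.
    apply: (@horner_ge0_limit _ _ _ 1); first by rewrite oner_eq0.
    by move=> e e0; apply: Spos; rewrite mul1r -subr_eq0 addrAC subrr add0r gt_eqF.
  exists (A * ('X - r%:P)), (B * ('X - r%:P)); split.
  - by rewrite PS SAB; ring.
  - by rewrite (leq_trans (size_polyMleq _ _)) // size_XsubC addnS /= addn1.
  - by rewrite (leq_trans (size_polyMleq _ _)) // size_XsubC addnS /= addn1.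
case=> al [be [be0 /dvdpP[S PS]]].
set Q := _ + _ in PS.
have Qpos x : 0 < Q.[x].
  rewrite hornerD horner_exp hornerXsubC hornerC ltr_wpDl ?sqr_ge0 //.
  by rewrite exprn_even_gt0 //= be0.
have S0 : S != 0 by apply: contraNneq P0 => S0; rewrite PS S0 mul0r.
have sQ : size Q = 3%N.
  rewrite /Q size_polyDl size_exp_XsubC //.
  by rewrite (leq_ltn_trans (size_polyC_leq1 _)).
have sS : (size S <= (2 * k).+1)%N.
  have Q0 : Q != 0 by rewrite -size_poly_gt0 sQ.
  by move: sP; rewrite PS size_mul // sQ addn3 mulnS.
have [x|A [B [SAB sA sB]]] := IH S sS.
  by have := Ppos x; rewrite PS hornerM pmulr_lge0.
have sX (D : {poly R}) :
    (size D <= k.+1)%N -> (size (D * ('X - al%:P))%R <= k.+2)%N.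
  move=> sD; rewrite (leq_trans (size_polyMleq _ _)) //.
  by rewrite size_XsubC addnS /= addn1.
have sC c (D : {poly R}) : (size D <= k.+1)%N -> (size (c *: D)%R <= k.+2)%N.
  by move=> sD; rewrite (leq_trans (size_scale_leq _ _)) // leqW.
exists (A * ('X - al%:P) - be *: B), (B * ('X - al%:P) + be *: A); split.
- by rewrite PS SAB /Q -!mul_polyC rmorphXn /=; ring.
- by rewrite (leq_trans (size_polyD _ _)) // size_polyN geq_max sX ?sC.
- by rewrite (leq_trans (size_polyD _ _)) // geq_max sX ?sC.
Qed.
(** * Congruences *)

Definition eqmod (K : comPzRingType) (d u v : K) : Prop := exists h, u - v = d * h.

Section Congruence.
Variables (K : comPzRingType) (d : K).

Lemma eqmod_refl u : eqmod d u u.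
Proof. by exists 0; rewrite subrr mulr0. Qed.

Lemma eqmod_sym u v : eqmod d u v -> eqmod d v u.
Proof. by move=> [h uv]; exists (- h); rewrite mulrN -uv opprB. Qed.

Lemma eqmod_trans v u w : eqmod d u v -> eqmod d v w -> eqmod d u w.
Proof.
by move=> [h uv] [k vw]; exists (h + k); rewrite mulrDr -uv -vw; ring.
Qed.

Lemma eqmodD u v u' v' :
  eqmod d u v -> eqmod d u' v' -> eqmod d (u + u') (v + v').
Proof.
by move=> [h uv] [k vw]; exists (h + k); rewrite mulrDr -uv -vw; ring.
Qed.

Lemma eqmodM u v u' v' :
  eqmod d u v -> eqmod d u' v' -> eqmod d (u * u') (v * v').
Proof.
move=> [h uv] [k uv']; exists (h * u' + v * k).
by rewrite mulrDr mulrA -uv [d * (v * k)]mulrCA -uv'; ring.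
Qed.

Lemma eqmodX u v k : eqmod d u v -> eqmod d (u ^+ k) (v ^+ k).
Proof.
move=> uv; elim: k => [|k IH]; first exact: eqmod_refl.
by rewrite !exprS; apply: eqmodM.
Qed.

Lemma eqmod_sum (I : eqType) (s : seq I) (F G : I -> K) :
  (forall i, i \in s -> eqmod d (F i) (G i)) ->
  eqmod d (\sum_(i <- s) F i) (\sum_(i <- s) G i).
Proof.
move=> FG; rewrite !big_seq; elim/big_ind2: _ => //; first exact: eqmod_refl.
by move=> u u' v v'; apply: eqmodD.
Qed.

(** Chinese remaindering of sums of two squares: M is an idempotent modulo
    q (M - 1), equal to 0 modulo q and to 1 modulo M - 1. *)
Lemma eqmod_crt (q m f K1 K2 L1 L2 : K) (M := q * m) :
  eqmod q f (L1 ^+ 2 + L2 ^+ 2) -> eqmod (M - 1) f (K1 ^+ 2 + K2 ^+ 2) ->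
  eqmod (q * (M - 1)) f
    ((M * K1 + (1 - M) * L1) ^+ 2 + (M * K2 + (1 - M) * L2) ^+ 2).
Proof.
move=> [A fA] [B fB].
have EK : K1 ^+ 2 + K2 ^+ 2 = f - (M - 1) * B by rewrite -fB; ring.
exists (- 2 * m * f + M * m * B + (M - 1) * A + 2 * m * (K1 * L1 + K2 * L2)).
have EL : L1 ^+ 2 + L2 ^+ 2 = f - q * A by rewrite -fA; ring.
have -> : (M * K1 + (1 - M) * L1) ^+ 2 + (M * K2 + (1 - M) * L2) ^+ 2 =
  M ^+ 2 * (K1 ^+ 2 + K2 ^+ 2) + (1 - M) ^+ 2 * (L1 ^+ 2 + L2 ^+ 2) +
  2 * M * (1 - M) * (K1 * L1 + K2 * L2) by ring.
by rewrite EK EL /M; ring.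
Qed.

End Congruence.

(** * Monomials on the curve x^a y^b = 1 *)

Section Weights.
Variables (a b : nat) (a_gt0 : (0 < a)%N) (cop : coprime a b).

(** The weight of x^i y^j is b i - a j, its exponent under x = t^b, y = t^-a.
    By coprimality two monomials of the same weight differ by a power of
    x^a y^b.  The hypothesis moves negative terms to the other side. *)
Lemma eqmod_weight (K : comPzRingType) (x y : K) (i j i' j' : nat) :
  (b * i + a * j' = b * i' + a * j)%N ->
  eqmod (x ^+ a * y ^+ b - 1) (x ^+ i * y ^+ j) (x ^+ i' * y ^+ j').
Proof.
wlog ii' : i j i' j' / (i' <= i)%N => [H|] eqw.
  have [/H|/ltnW/H H'] := leqP i' i; first exact.
  exact/eqmod_sym/H'.
have jj' : (j' <= j)%N.
  rewrite -(leq_pmul2l a_gt0) -(leq_add2l (b * i')) -eqw leq_add2r.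
  by rewrite leq_mul2l ii' orbT.
have eqd : (b * (i - i') = a * (j - j'))%N by rewrite !mulnBr; lia.
have /dvdnP[k ik] : (a %| i - i')%N.
  by rewrite -(Gauss_dvdr _ cop) eqd dvdn_mulr.
have jk : (j - j' = k * b)%N.
  apply/eqP; rewrite -(eqn_pmul2l a_gt0) -eqd ik; apply/eqP; lia.
rewrite -(subnK ii') -(subnK jj') ik jk !exprD.
have -> : x ^+ (k * a) * x ^+ i' * (y ^+ (k * b) * y ^+ j') =
          (x ^+ a * y ^+ b) ^+ k * (x ^+ i' * y ^+ j').
  by rewrite exprMn -!exprM (mulnC k a) (mulnC k b); ring.
rewrite -[X in eqmod _ _ X]mul1r -{2}(expr1n _ k).
apply: eqmodM; last exact: eqmod_refl.
by apply: eqmodX; exists 1; rewrite mulr1.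
Qed.

End Weights.

(** Among the monomials of weight m >= 0, the one with j < b has
    i = (a j + m) / b <= a + n. *)
Lemma nonneg_weight_exponents (a b n m : nat) :
  (0 < b)%N -> coprime a b -> (m <= b * n)%N ->
  exists i j : nat, (b * i = a * j + m)%N /\ (i + j <= n + a + b)%N.
Proof.
move=> b_gt0 cop mn.
have [v _ bv] := Bezoutl a b_gt0.
rewrite gcdnC (eqP cop) in bv.
pose j := ((m * v) %% b)%N.
have /dvdnP[i Ei] : (b %| a * j + m)%N.
  rewrite /dvdn -modnDml modnMmr modnDml.
  (* v is the opposite of the inverse of a modulo b *)
  have -> : (a * (m * v) + m = m * (1 + v * a))%N by lia.
  by apply: dvdn_mull.
exists i, j; split; first by rewrite Ei mulnC.
have jb : (j < b)%N by rewrite ltn_mod.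
have : (i <= n + a)%N.
  have : (a * j <= a * b)%N by rewrite leq_mul2l ltnW ?orbT.
  by move=> ?; rewrite -(leq_pmul2r b_gt0) -Ei; lia.
by lia.
Qed.

(** Monomials of weight k - a n.  Negative weights reduce to positive ones by
    exchanging the two variables. *)
Lemma low_degree_exponents (a b n k : nat) :
  (0 < a)%N -> (0 < b)%N -> coprime a b -> (k <= n * (a + b))%N ->
  exists i j : nat, (b * i + a * n = a * j + k)%N /\ (i + j <= n + a + b)%N.
Proof.
move=> a_gt0 b_gt0 cop kn; have [ak|/ltnW ka] := leqP (a * n) k.
  have [|i [j [E le]]] := @nonneg_weight_exponents a b n (k - a * n) b_gt0 cop.
    by lia.
  by exists i, j; split => //; lia.
have [||j [i [E le]]] := @nonneg_weight_exponents b a n (a * n - k) a_gt0.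
- by rewrite coprime_sym.
- by lia.
by exists i, j; split => //; lia.
Qed.

(** * Bivariate polynomials *)

Section Degree.
Variable R : realType.
Implicit Types (f g : {mpoly R[2]}).

Lemma deg_leW k l f : (k <= l)%N -> deg_le k f -> deg_le l f.
Proof. by rewrite /deg_le => kl /leq_trans; apply. Qed.

Lemma deg_leD k f g : deg_le k f -> deg_le k g -> deg_le k (f + g).
Proof.
by move=> fk gk; apply: leq_trans (mmeasureD_le _ _ _) _; rewrite geq_max fk gk.
Qed.

Lemma deg_leN k f : deg_le k f -> deg_le k (- f).
Proof. by rewrite /deg_le mmeasureN. Qed.

Lemma deg_leZ k c f : deg_le k f -> deg_le k (c *: f).
Proof. by apply: leq_trans; apply: msizeZ_le. Qed.

Lemma deg_leM k l f g : deg_le k f -> deg_le l g -> deg_le (k + l) (f * g).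
Proof.
rewrite /deg_le; have [->|f0] := eqVneq f 0; first by rewrite mul0r msize0.
have [->|g0] := eqVneq g 0; first by rewrite mulr0 msize0.
move=> fk gk; rewrite msizeM // -subn1 leq_subLR.
by apply: leq_trans (leq_add fk gk) _; rewrite addSn addnS.
Qed.

Lemma deg_le1 k : deg_le k (1 : {mpoly R[2]}).
Proof. by rewrite /deg_le msize1. Qed.

Lemma deg_leX i k : deg_le k ('X_i ^+ k : {mpoly R[2]}).
Proof. by rewrite /deg_le mpolyXn msizeX mdegMn mdeg1 mul1n. Qed.

Lemma deg_le_sum (I : Type) (s : seq I) (P : pred I) (F : I -> {mpoly R[2]}) k :
  (forall i, P i -> deg_le k (F i)) -> deg_le k (\sum_(i <- s | P i) F i).
Proof.
move=> Fk; elim/big_ind: _ => //; last by move=> u v; apply: deg_leD.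
by rewrite /deg_le msize0.
Qed.

Lemma mpolyX2 (i j : 'I_2) (m : 'X_{1..2}) : i != j ->
  'X_[m] = 'X_i ^+ m i * 'X_j ^+ m j :> {mpoly R[2]}.
Proof.
by move=> ij; rewrite mpolyXE_id (bigD1 i) //= (big_pred1 j) // => k;
   case: i k j ij => [[|[|?]] ?] [[|[|?]] ?] [[|[|?]] ?].
Qed.

Lemma mpolyE2 (i j : 'I_2) f : i != j ->
  f = \sum_(m <- msupp f) f@_m *: ('X_i ^+ m i * 'X_j ^+ m j).
Proof.
by move=> ij; rewrite {1}[f]mpolyE; apply: eq_bigr => m _; rewrite (mpolyX2 _ ij).
Qed.

Lemma meval2E (i j : 'I_2) f (v : 'I_2 -> R) : i != j ->
  f.@[v] = \sum_(m <- msupp f) f@_m * (v i ^+ m i * v j ^+ m j).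
Proof.
move=> ij; rewrite {1}(mpolyE2 f ij) raddf_sum /=; apply: eq_bigr => m _.
by rewrite mevalZ mevalM !rmorphXn /= !mevalXU.
Qed.

Lemma msupp_deg2 (i j : 'I_2) f k m : i != j -> deg_le k f ->
  m \in msupp f -> (m i + m j <= k)%N.
Proof.
move=> ij fk /msize_mdeg_lt mf.
have := leq_trans mf fk; rewrite ltnS mdegE (bigD1 i) //= (big_pred1 j) // => l.
by case: i l j ij => [[|[|?]] ?] [[|[|?]] ?] [[|[|?]] ?].
Qed.

Lemma eqmodZ (d u v : {mpoly R[2]}) c : eqmod d u v -> eqmod d (c *: u) (c *: v).
Proof. by move=> [h uv]; exists (c *: h); rewrite -scalerBr uv scalerAr. Qed.

Lemma horner_algZXn (w : {mpoly R[2]}) c k :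
  horner_alg w (c *: 'X^k) = c *: w ^+ k.
Proof. by rewrite linearZ /= rmorphXn /= horner_algX mulr_algl. Qed.

Lemma horner_algE (w : {mpoly R[2]}) (G : {poly R}) N : (size G <= N)%N ->
  horner_alg w G = \sum_(k < N) G`_k *: w ^+ k.
Proof.
move=> sG; have EG : G = \sum_(k < N) G`_k *: 'X^k.
  rewrite -poly_def; apply/polyP => k; rewrite coef_poly; case: ltnP => //.
  by move=> /(leq_trans sG)/(nth_default 0).
rewrite {1}EG raddf_sum /=; apply: eq_bigr => k _.
exact: horner_algZXn.
Qed.

Lemma deg_le_horner i k (G : {poly R}) :
  (size G <= k.+1)%N -> deg_le k (horner_alg ('X_i : {mpoly R[2]}) G).
Proof.
move=> sG; rewrite (horner_algE _ sG); apply: deg_le_sum => l _.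
by apply: deg_leZ; apply: deg_leW (deg_leX i l); rewrite -ltnS.
Qed.

End Degree.
(** * The coordinate axes *)

Section Axes.
Variable R : realType.
Implicit Types (f : {mpoly R[2]}).

(** The restriction of f to the axis where the coordinate i vanishes, as a
    polynomial in the other coordinate j. *)
Definition axis_restr (i j : 'I_2) f : {poly R} :=
  \sum_(m <- msupp f) f@_m *: ((m i == 0%N)%:R *: 'X^(m j)).

Lemma size_axis_restr (i j : 'I_2) f k : i != j -> deg_le k f ->
  (size (axis_restr i j f) <= k.+1)%N.
Proof.
move=> ij fk; rewrite /axis_restr big_seq; elim/big_ind: _ => [|u v su sv|m mf].
- by rewrite size_poly0.
- by rewrite (leq_trans (size_polyD _ _)) // geq_max su sv.
- rewrite (leq_trans (size_scale_leq _ _)) // (leq_trans (size_scale_leq _ _)) //.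
  by rewrite size_polyXn ltnS; have := msupp_deg2 ij fk mf; lia.
Qed.

Lemma horner_axis_restr (i j : 'I_2) f t : i != j ->
  (axis_restr i j f).[t] = f.@[fun k => if k == j then t else 0].
Proof.
move=> ij; rewrite (meval2E _ _ ij) horner_sum; apply: eq_bigr => m _.
by rewrite !hornerZ hornerXn (negPf ij) eqxx expr0n.
Qed.

(** f(x, y) = f(0, y) + f(x, 0) - f(0, 0) modulo x y, because a monomial that is
    not a multiple of x y lives on one axis. *)
Lemma axis_decomposition f :
  eqmod (xvar * yvar) f
    (horner_alg yvar (axis_restr 0 1 f) + horner_alg xvar (axis_restr 1 0 f)
     - (f.@[fun=> 0])%:MP).
Proof.
have n01 : 0 != 1 :> 'I_2 by [].
set rhs := _ - _.
have -> : rhs = \sum_(m <- msupp f) f@_m *: ((m 0 == 0%N)%:R *: yvar ^+ m 1 +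
    (m 1 == 0%N)%:R *: xvar ^+ m 0 - ((0 ^+ m 0 * 0 ^+ m 1)%R : R)%:MP).
  under eq_bigr => m _ do rewrite scalerBr scalerDr.
  rewrite sumrB big_split /= /rhs; congr (_ + _ - _).
  - rewrite raddf_sum; apply: eq_bigr => m _ /=.
    by rewrite scalerA horner_algZXn scalerA.
  - rewrite raddf_sum; apply: eq_bigr => m _ /=.
    by rewrite scalerA horner_algZXn scalerA.
  - rewrite (meval2E _ _ n01) raddf_sum; apply: eq_bigr => m _ /=.
    by rewrite mpolyCM mul_mpolyC.
rewrite {1}(mpolyE2 f n01).
apply: eqmod_sum => m _; apply: eqmodZ.
rewrite !expr0n -natrM mulnb; case: (m 0) => [|i]; case: (m 1) => [|j] /=;
  rewrite ?scale1r ?scale0r ?mpolyC1 ?mpolyC0 ?expr0 ?mulr1 ?mul1r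
    ?subr0 ?addr0 ?add0r ?addrK;
  try exact: eqmod_refl.
by exists ('X_0 ^+ i * 'X_1 ^+ j); rewrite subr0 /xvar /yvar !exprS; ring.
Qed.

Lemma horner_alg_const (w : {mpoly R[2]}) (G : {poly R}) :
  exists h, horner_alg w G = (G.[0])%:MP + w * h.
Proof.
have /factor_theorem[S GS] : root (G - G.[0]%:P) 0 by rewrite rootE !hornerE subrr.
exists (horner_alg w S).
rewrite -[in LHS](subrK G.[0]%:P G) GS subr0 rmorphD rmorphM /= horner_algX.
by rewrite horner_algC -mul_mpolyC mulr1; ring.
Qed.

(** Rotating the pair (A, B) so that its value at 0 lies on the first half-axis
    makes that value depend on P(0) only; representations on two lines through
    a point then match at the point. *)
Lemma nonneg_poly_sum2sqr_normalized (k : nat) (P : {poly R}) :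
  (size P <= (2 * k).+1)%N -> (forall x, 0 <= P.[x]) -> 0 < P.[0] ->
  exists A B : {poly R}, [/\ P = A ^+ 2 + B ^+ 2,
    (size A <= k.+1)%N, (size B <= k.+1)%N,
    A.[0] = Num.sqrt P.[0] & B.[0] = 0].
Proof.
move=> sP Ppos P0; have [A [B [PAB sA sB]]] := nonneg_poly_sum2sqr sP Ppos.
set s := Num.sqrt P.[0].
have s0 : s != 0 by rewrite gt_eqF // sqrtr_gt0.
have s2 : s ^+ 2 = A.[0] ^+ 2 + B.[0] ^+ 2.
  by rewrite sqr_sqrtr ?ltW // PAB hornerD !horner_exp.
set u := A.[0] in s2 *; set v := B.[0] in s2 *.
have sD c d (C D : {poly R}) : (size C <= k.+1)%N -> (size D <= k.+1)%N ->
  (size (c *: C + d *: D)%R <= k.+1)%N.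
  move=> sC sD; rewrite (leq_trans (size_polyD _ _)) // geq_max.
  by rewrite !(leq_trans (size_scale_leq _ _)).
exists ((u / s) *: A + (v / s) *: B), ((- (v / s)) *: A + (u / s) *: B); split.
- have uv1 : (u / s) ^+ 2 + (v / s) ^+ 2 = 1.
    by rewrite !exprMn -mulrDl -s2 -exprMn divff // expr1n.
  rewrite PAB -!mul_polyC polyCN.
  have -> : forall c d C D : {poly R}, (c * C + d * D) ^+ 2 + ((-d) * C + c * D)^+2
    = (c ^+ 2 + d ^+ 2) * (C ^+ 2 + D ^+ 2) by move=> *; ring.
  by rewrite -!rmorphXn -rmorphD uv1 mul1r.
- exact: sD.
- exact: sD.
- rewrite hornerD !hornerZ -/u -/v; apply: (mulIf s0); rewrite -expr2 s2.
  by field.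
- by rewrite hornerD !hornerZ -/u -/v; field.
Qed.

Lemma axes_sum2sqr n f q : q \in [:: xvar; yvar; xvar * yvar] ->
  deg_le (2 * n) f -> positive_on (zero_set q) f ->
  exists L1 L2, [/\ deg_le n L1, deg_le n L2 & eqmod q f (L1 ^+ 2 + L2 ^+ 2)].
Proof.
move=> hq hf hpos; have [h Ef] := axis_decomposition f.
set c := f.@[_] in Ef.
have n01 : 0 != 1 :> 'I_2 by [].
have n10 : 1 != 0 :> 'I_2 by [].
pose P (i j : 'I_2) := axis_restr i j f.
have P0 i j : i != j -> (P i j).[0] = c.
  by move=> ij; rewrite horner_axis_restr //; apply: meval_eq => k; case: ifP.
have sP i j : i != j -> (size (P i j) <= (2 * n).+1)%N.
  by move=> ij; apply: size_axis_restr.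
have Ppos i j : i != j -> (forall v, v i = 0 -> q.@[v] = 0) ->
    forall t, 0 < (P i j).[t].
  move=> ij qv t; rewrite horner_axis_restr //; apply: hpos.
  by apply: qv; rewrite (negPf ij).
have Ef' : f = horner_alg yvar (P 0 1) + horner_alg xvar (P 1 0) - c%:MP
               + xvar * yvar * h.
  by rewrite -Ef; ring.
(* With c = f(0, 0), the term f(x, 0) - c is a multiple of x and f(0, y) - c is
   a multiple of y. *)
have [hx Ex] := horner_alg_const xvar (P 1 0).
have [hy Ey] := horner_alg_const yvar (P 0 1).
rewrite P0 // in Ex; rewrite P0 // in Ey.
move: hq; rewrite !inE => /or3P[]/eqP Eq; rewrite Eq in hpos Ppos *.
- have [|t|A [B [PAB sA sB]]] := @nonneg_poly_sum2sqr _ n (P 0 1).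
  + exact: sP.
  + by apply/ltW/Ppos => // v v0; rewrite mevalXU.
  exists (horner_alg yvar A), (horner_alg yvar B).
  split; [exact: deg_le_horner|exact: deg_le_horner|].
  have <- : horner_alg yvar (P 0 1) =
            horner_alg yvar A ^+ 2 + horner_alg yvar B ^+ 2.
    by rewrite PAB rmorphD !rmorphXn.
  by exists (yvar * h + hx); rewrite Ef' Ex; ring.
- have [|t|A [B [PAB sA sB]]] := @nonneg_poly_sum2sqr _ n (P 1 0).
  + exact: sP.
  + by apply/ltW/Ppos => // v v0; rewrite mevalXU.
  exists (horner_alg xvar A), (horner_alg xvar B).
  split; [exact: deg_le_horner|exact: deg_le_horner|].
  have <- : horner_alg xvar (P 1 0) =
            horner_alg xvar A ^+ 2 + horner_alg xvar B ^+ 2.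
    by rewrite PAB rmorphD !rmorphXn.
  by exists (xvar * h + hy); rewrite Ef' Ey; ring.
have Py t : 0 < (P 0 1).[t].
  by apply: Ppos => // v v0; rewrite mevalM !mevalXU v0 mul0r.
have Px t : 0 < (P 1 0).[t].
  by apply: Ppos => // v v0; rewrite mevalM !mevalXU v0 mulr0.
have [|A1 [B1 [PAB1 sA1 sB1 A10 B10]]] :=
  nonneg_poly_sum2sqr_normalized (sP 0 1 n01) _ (Py 0);
  first by move=> t; apply: ltW.
have [|A2 [B2 [PAB2 sA2 sB2 A20 B20]]] :=
  nonneg_poly_sum2sqr_normalized (sP 1 0 n10) _ (Px 0);
  first by move=> t; apply: ltW.
rewrite P0 // in A10; rewrite P0 // in A20.
set s := Num.sqrt c in A10 A20.
have cs : c = s ^+ 2 by rewrite sqr_sqrtr // -(P0 0 1) // ltW.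
(* A1(y) + A2(x) - s restricts to A1 and to A2 on the two axes because both have
   the value s at the origin. *)
exists (horner_alg yvar A1 + horner_alg xvar A2 - s%:MP),
       (horner_alg yvar B1 + horner_alg xvar B2); split.
- apply: deg_leD; first by apply: deg_leD; apply: deg_le_horner.
  by apply: deg_leN; rewrite -[s%:MP]mulr1 mul_mpolyC; apply/deg_leZ/deg_le1.
- by apply: deg_leD; apply: deg_le_horner.
rewrite Ef' PAB1 PAB2 !rmorphD !rmorphXn /= cs rmorphXn /=.
have [a1 ->] := horner_alg_const yvar A1; have [a2 ->] := horner_alg_const xvar A2.
have [b1 ->] := horner_alg_const yvar B1; have [b2 ->] := horner_alg_const xvar B2.
rewrite A10 A20 B10 B20 mpolyC0.
by exists (h - 2 * (a1 * a2 + b1 * b2)); ring.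
Qed.

End Axes.

(** * The curve x^a y^b = 1 *)

Section Curve.
Variables (R : realType) (a b : nat).
Hypotheses (a_gt0 : (0 < a)%N) (b_gt0 : (0 < b)%N) (cop : coprime a b).
Let M : {mpoly R[2]} := xvar ^+ a * yvar ^+ b.

(** The polynomial t^(2na) f(t^b, t^-a) when f has degree at most 2n; the
    truncated subtraction is exact in that case. *)
Definition curve_pullback n (f : {mpoly R[2]}) : {poly R} :=
  \sum_(m <- msupp f) f@_m *: 'X^(b * m 0 + a * (2 * n - m 1)).

Definition curve_point (t : R) : 'I_2 -> R :=
  fun i => if i == 0 then t ^+ b else t^-1 ^+ a.

Let n01 : 0 != 1 :> 'I_2. Proof. by []. Qed.

Lemma size_curve_pullback n f : deg_le (2 * n) f ->
  (size (curve_pullback n f) <= (2 * (n * (a + b))).+1)%N.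
Proof.
move=> fn; rewrite /curve_pullback big_seq; elim/big_ind: _ => [|u v su sv|m mf].
- by rewrite size_poly0.
- by rewrite (leq_trans (size_polyD _ _)) // geq_max su sv.
rewrite (leq_trans (size_scale_leq _ _)) // size_polyXn ltnS.
have := msupp_deg2 n01 fn mf; move: (m 0) (m 1) => i j ij.
have -> : (2 * (n * (a + b)) = b * (2 * n) + a * (2 * n))%N by lia.
by rewrite leq_add // leq_mul2l; apply/orP; right; lia.
Qed.

Lemma horner_curve_pullback n f t : deg_le (2 * n) f -> t != 0 ->
  (curve_pullback n f).[t] = (t ^+ (a * n)) ^+ 2 * f.@[curve_point t].
Proof.
move=> fn t0; rewrite (meval2E _ _ n01) horner_sum mulr_sumr.
rewrite big_seq [RHS]big_seq; apply: eq_bigr => m mf.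
have := msupp_deg2 n01 fn mf; move: (m 0) (m 1) => i j ij.
rewrite hornerZ hornerXn mulrCA; congr (_ * _).
rewrite /curve_point /= -!exprM.
have -> : (a * n * 2 = a * (2 * n - j) + a * j)%N by rewrite -mulnDr subnK; lia.
by rewrite !exprD mulrACA exprVn mulfV ?expf_neq0 // mulr1 mulrC.
Qed.

(** The monomial w has weight b u - a v = 1, so that it represents the
    coordinate t on the curve, while y^n represents t^(-an). *)
Section Uniformizer.
Variables (u v : nat) (uv : (b * u = a * v + 1)%N).
Let w : {mpoly R[2]} := xvar ^+ u * yvar ^+ v.

Lemma eqmod_curve_pullback n f : deg_le (2 * n) f ->
  eqmod (M - 1) f (yvar ^+ (2 * n) * horner_alg w (curve_pullback n f)).
Proof.
move=> fn; rewrite {1}(mpolyE2 f n01) raddf_sum mulr_sumr /=.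
apply: eqmod_sum => m mf; rewrite horner_algZXn -scalerAr; apply: eqmodZ.
have := msupp_deg2 n01 fn mf; move: (m 0) (m 1) => i j ij.
set e := (_ + _)%N; rewrite exprMn -!exprM mulrCA -exprD.
apply: eqmod_weight => //.
have -> : (b * (u * e) = (a * v + 1) * e)%N by rewrite -uv; lia.
have -> : (a * (2 * n + v * e) = a * v * e + (a * (2 * n - j) + a * j))%N.
  by rewrite -mulnDr subnK; lia.
by rewrite mulnDl mul1n {2}/e; lia.
Qed.

(** Replaces each term y^n w^k of y^n G(w), whose degree is out of control, by a
    monomial of the same weight and of low degree. *)
Lemma low_degree_lift n (G : {poly R}) : (size G <= (n * (a + b)).+1)%N ->
  exists K, deg_le (n + a + b) K /\ eqmod (M - 1) K (yvar ^+ n * horner_alg w G).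
Proof.
move=> sG; rewrite (horner_algE w sG).
suff lift N : (N <= (n * (a + b)).+1)%N -> exists K, deg_le (n + a + b) K /\
    eqmod (M - 1) K (yvar ^+ n * \sum_(k < N) G`_k *: w ^+ k) by exact: lift.
elim: N => [|N IH] leN.
  exists 0; split; first by rewrite /deg_le msize0.
  by rewrite big_ord0 mulr0; apply: eqmod_refl.
have [K [Kdeg KG]] := IH (ltnW leN).
have [i [j [E le]]] := @low_degree_exponents a b n N a_gt0 b_gt0 cop leN.
exists (K + G`_N *: (xvar ^+ i * yvar ^+ j)); split.
  apply: deg_leD => //; apply/deg_leZ/(deg_leW le).
  by apply: deg_leM; apply: deg_leX.
rewrite big_ord_recr /= mulrDr; apply: eqmodD => //.
rewrite -scalerAr; apply: eqmodZ; rewrite exprMn -!exprM mulrCA -exprD.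
apply: eqmod_weight => //.
have -> : (b * (u * N) = (a * v + 1) * N)%N by rewrite -uv; lia.
by rewrite !mulnDr addnA E mulnA; lia.
Qed.

End Uniformizer.

Lemma curve_sum2sqr n f : deg_le (2 * n) f ->
  (forall t, t != 0 -> 0 <= f.@[curve_point t]) ->
  exists K1 K2, [/\ deg_le (n + a + b) K1, deg_le (n + a + b) K2
    & eqmod (M - 1) f (K1 ^+ 2 + K2 ^+ 2)].
Proof.
move=> fn fpos.
have [u [v uv]] : exists u v, (b * u = a * v + 1)%N.
  have [v _] := Bezoutl a b_gt0; rewrite gcdnC (eqP cop) => /dvdnP[u E].
  by exists u, v; lia.
have Fpos t : t != 0 -> 0 <= (curve_pullback n f).[t].
  by move=> t0; rewrite horner_curve_pullback // mulr_ge0 ?sqr_ge0 ?fpos.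
have [|t|A [B [FAB sA sB]]] :=
  @nonneg_poly_sum2sqr _ (n * (a + b)) (curve_pullback n f).
- exact: size_curve_pullback.
- have [->|] := eqVneq t 0; last exact: Fpos.
  (* The parametrization omits t = 0, where the sign follows by continuity. *)
  apply: (@horner_ge0_limit _ _ _ 1); first by rewrite oner_eq0.
  by move=> e e0; apply: Fpos; rewrite mul1r add0r gt_eqF.
have [K1 [d1 E1]] := low_degree_lift uv sA.
have [K2 [d2 E2]] := low_degree_lift uv sB.
exists K1, K2; split => //.
apply: eqmod_trans (eqmod_curve_pullback uv fn) _.
rewrite FAB rmorphD !rmorphXn /= mulrDr mulnC exprM -!exprMn.
by apply: eqmod_sym; apply: eqmodD; apply: eqmodX.
Qed.

End Curve.

(** * Gluing *)

Theorem corollary4p5 (R : realType) (l1 l2 : nat) (q p : {mpoly R[2]}) (n : nat)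
    (hl1 : (1 < l1)%N) (hl2 : (1 < l2)%N) (hgcd : gcdn l1 l2 = 1%N)
    (hq : q \in [:: xvar; yvar; xvar * yvar])
    (hp : p = q * (xvar ^+ l1 * yvar ^+ l2 - 1))
    (hn : deg_le n p)
    (f : {mpoly R[2]}) (hf : deg_le (2 * n) f)
    (hpos : positive_on (zero_set p) f) :
  exists (r : nat) (g : 'I_r -> {mpoly R[2]}) (h : {mpoly R[2]}),
    [/\ f = \sum_(j < r) g j ^+ 2 + p * h,
        forall j, deg_le (2 * (n + 2 * (l1 + l2))) (g j ^+ 2)
      & deg_le (2 * (n + 2 * (l1 + l2))) (p * h)].
Proof.
have l1_gt0 := ltnW hl1; have l2_gt0 := ltnW hl2.
set M := xvar ^+ l1 * yvar ^+ l2 in hp.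
have [L1 [L2 [dL1 dL2 fL]]] : exists L1 L2,
    [/\ deg_le n L1, deg_le n L2 & eqmod q f (L1 ^+ 2 + L2 ^+ 2)].
  apply: axes_sum2sqr => // z qz; apply: hpos.
  by rewrite /zero_set hp mevalM qz mul0r.
have [K1 [K2 [dK1 dK2 fK]]] : exists K1 K2,
    [/\ deg_le (n + l1 + l2) K1, deg_le (n + l1 + l2) K2
      & eqmod (M - 1) f (K1 ^+ 2 + K2 ^+ 2)].
  apply: curve_sum2sqr => //; first exact/eqP.
  move=> t t0; apply/ltW/hpos; rewrite /zero_set hp mevalM mevalB meval1.
  rewrite mevalM !rmorphXn /= !mevalXU /curve_point /= -!exprM (mulnC l2).
  by rewrite -exprMn mulfV // expr1n subrr mulr0.
have [m Mm] : exists m, M = q * m.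
  rewrite /M -(prednK l1_gt0) -(prednK l2_gt0) !exprS.
  move: hq; rewrite !inE => /or3P[]/eqP ->.
  - by exists (xvar ^+ l1.-1 * (yvar * yvar ^+ l2.-1)); ring.
  - by exists (xvar * xvar ^+ l1.-1 * yvar ^+ l2.-1); ring.
  - by exists (xvar ^+ l1.-1 * yvar ^+ l2.-1); ring.
rewrite Mm in fK; have [h] := eqmod_crt fL fK; rewrite -Mm -hp => fh.
have dM : deg_le (l1 + l2) M by apply: deg_leM; apply: deg_leX.
have dg K L : deg_le (n + l1 + l2) K -> deg_le n L ->
    deg_le (2 * (n + 2 * (l1 + l2))) ((M * K + (1 - M) * L) ^+ 2).
  move=> dK dL; rewrite mul2n -addnn expr2.
  suff d : deg_le (n + 2 * (l1 + l2)) (M * K + (1 - M) * L) by apply: deg_leM.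
  apply: deg_leD; first by apply: deg_leW (deg_leM dM dK); lia.
  apply: (@deg_leW _ (l1 + l2 + n)); first by lia.
  by apply: deg_leM => //; apply/deg_leD; [apply: deg_le1|apply: deg_leN].
exists 2%N, (fun j => if j == 0 then M * K1 + (1 - M) * L1
                      else M * K2 + (1 - M) * L2), h; split.
- by rewrite !big_ord_recl big_ord0 /= addr0 -fh addrC subrK.
- by move=> j; case: ifP => _; apply: dg.
rewrite -fh; apply: deg_leD; first by apply: deg_leW hf; lia.
by apply/deg_leN/deg_leD; apply: dg.
Qed.
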